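(* There exist $n_0\in\mathbf{N}$ and $\epsilon_0>0$ such that, for any natural number $n\geq n_0$ and any real $\epsilon$ with $0<\epsilon\leq\epsilon_0$, there is no first-order formula $\psi(x_1,\ldots,x_n)$ in the language of groups such that, for every group $G$ and every $\vec a\in G^n$, $$G\models\psi(\vec a)\iff \text{there is no } (\vec a,\epsilon)\text{-Følner subset of } G.$$
   Context: For a group $G$, a finite subset $F\subseteq G$ and $\epsilon>0$, a finite subset $H\subseteq G$ is called an $(F,\epsilon)$-Følner set if $|gH\triangle H|<\epsilon|H|$ for all $g\in F$. For a tuple $\vec a=(a_1,\ldots,a_n)\in G^n$, an $(\vec a,\epsilon)$-Følner set means an $(\{a_1,\ldots,a_n\},\epsilon)$-Følner set. First-order formulas are finitary formulas without parameters. *)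

(* Defs.v *)
From HB Require Import structures.
From mathcomp Require Import all_boot all_order all_algebra.
From mathcomp Require Import finmap reals.

Set Implicit Arguments.
Unset Strict Implicit.
Unset Printing Implicit Defensive.

(* Carriers are groupType's: arbitrary, possibly infinite groups. A groupType
   also carries a choiceType structure, which under the classical axioms of
   mathcomp.classical.boolp exists on every type, hence is no restriction. *)

Inductive gterm (n : nat) : Type :=
  | GVar of 'I_n
  | GOne
  | GInv of gterm n
  | GMul of gterm n & gterm n.

(* [gformula n] is the type of formulas whose free variables are among
   x_0, ..., x_(n-1). A quantifier binds variable 0 of its body (a formula in
   n.+1 variables) and shifts the variables in scope up by one. *)
Inductive gformula : nat -> Type :=
  | GFalse n : gformula n
  | GEq n : gterm n -> gterm n -> gformula n
  | GNot n : gformula n -> gformula n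
  | GAnd n : gformula n -> gformula n -> gformula n
  | GOr n : gformula n -> gformula n -> gformula n
  | GImp n : gformula n -> gformula n -> gformula n
  | GAll n : gformula n.+1 -> gformula n
  | GEx n : gformula n.+1 -> gformula n.

Fixpoint geval (G : groupType) (n : nat) (a : n.-tuple G) (t : gterm n) : G :=
  match t with
  | GVar i => tnth a i
  | GOne => 1%g
  | GInv u => (geval a u)^-1%g
  | GMul u v => (geval a u * geval a v)%g
  end.

Fixpoint gsat (G : groupType) (n : nat) (phi : gformula n) :
    n.-tuple G -> Prop :=
  match phi in gformula m return m.-tuple G -> Prop with
  | GFalse _ => fun=> False
  | GEq _ t u => fun a => geval a t = geval a u
  | GNot _ f => fun a => ~ gsat f a
  | GAnd _ f g => fun a => gsat f a /\ gsat g a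
  | GOr _ f g => fun a => gsat f a \/ gsat g a
  | GImp _ f g => fun a => gsat f a -> gsat g a
  | GAll _ f => fun a => forall x : G, gsat f (cons_tuple x a)
  | GEx _ f => fun a => exists x : G, gsat f (cons_tuple x a)
  end.

Local Open Scope fset_scope.

Definition ltranslate (G : groupType) (g : G) (H : {fset G}) : {fset G} :=
  [fset (g * x)%g | x in H].

Definition fsymdiff (T : choiceType) (A B : {fset T}) : {fset T} :=
  (A `\` B) `|` (B `\` A).

Definition Folner (R : realType) (G : groupType) (F : {fset G}) (eps : R)
    (H : {fset G}) : Prop :=
  forall g : G, g \in F ->
    ((#|` fsymdiff (ltranslate g H) H|)%:R < eps * (#|` H|)%:R)%R.

Definition tuple_Folner (R : realType) (G : groupType) (n : nat)
    (a : n.-tuple G) (eps : R) (H : {fset G}) : Prop :=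
  Folner [fset tnth a i | i : 'I_n] eps H.

(* Main.v *)
(* If psi defined the tuples without a Folner set, its negation would hold in
   every finite group, where the whole group is a Folner set, hence in every
   ultraproduct of finite groups. But Biggs' involutions (swapping the
   endpoints of the edges of a given colour in the ball of radius k of the
   3-regular tree with properly coloured edges) satisfy no relation of length
   at most k apart from their squares being trivial, since a reduced word moves
   the centre of the ball along a path; so in the ultraproduct of the groups
   they live in they generate a free product of three groups of order 2. The
   left Cayley graph of the latter is a forest with constant degree 3, so that
   a finite set H contains at most |H| of the 3|H|/2 edges it would need to be
   invariant, which rules out Folner sets for eps <= 1/2. *)

Require Import Defs.
From HB Require Import structures.
From mathcomp Require Import all_boot all_order all_algebra all_fingroup.
From mathcomp Require Import generic_quotient finmap reals.
From mathcomp Require Import boolp classical_sets filter.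
From mathcomp Require Import lra zify.

Set Implicit Arguments.
Unset Strict Implicit.
Unset Printing Implicit Defensive.

(** * Reduced words and Biggs' involutions on balls of a coloured tree *)

Definition reduced (I : eqType) (w : seq I) : bool :=
  sorted (fun i j => i != j) w.

(** Left multiplication by the generator [i] on normal forms in the free product of groups of order
    2 indexed by [I]. *)
Definition toggle (I : eqType) (i : I) (w : seq I) : seq I :=
  if w is j :: v then if i == j then v else i :: w else [:: i].

Lemma toggle_notin (I : eqType) (i : I) (w : seq I) :
  reduced (i :: w) -> toggle i w = i :: w.
Proof. by case: w => //= j w /andP[/negPf->]. Qed.

Lemma reduced_toggle (I : eqType) (i : I) (w : seq I) :
  reduced w -> reduced (toggle i w).
Proof.
case: w => //= j w jw; case: eqVneq => [_|ij] /=; first exact: path_sorted jw.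
by rewrite ij.
Qed.

Lemma toggleK (I : eqType) (i : I) (w : seq I) :
  reduced w -> toggle i (toggle i w) = w.
Proof.
case: w => [|j w] /=; first by rewrite eqxx.
case: eqVneq => [->|ij] jw /=; last by rewrite eqxx.
exact: toggle_notin.
Qed.

(* [insubd w] makes the words whose toggle would leave the ball fixed points. *)
Definition ball_flip (I : eqType) (k : nat) (i : I) (w : k.-bseq I) :
    k.-bseq I :=
  if reduced w then insubd w (toggle i w) else w.

Lemma ball_flipK (I : eqType) (k : nat) (i : I) :
  involutive (@ball_flip I k i).
Proof.
move=> w; rewrite {2}/ball_flip; case: ifPn => rw; last first.
  by rewrite /ball_flip (negPf rw).
rewrite /insubd; case: insubP => [v vk ev|wk] /=; last first.
  by rewrite /ball_flip rw /insubd insubN.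
rewrite /ball_flip ev reduced_toggle // toggleK //.
by apply: val_inj; rewrite val_insubd size_bseq.
Qed.

Definition ball_perm (I : finType) (k : nat) (i : I) : {perm k.-bseq I} :=
  perm (can_inj (@ball_flipK I k i)).

Lemma ball_permK (I : finType) (k : nat) (i : I) :
  (ball_perm k i * ball_perm k i = 1)%g.
Proof. by apply/permP => w; rewrite permM perm1 !permE ball_flipK. Qed.

(** Products of permutations apply the leftmost factor first, so the word comes out reversed. Each
    letter lengthens the word reached so far, and the bound by [k] keeps it in the ball, where the
    flip really toggles. *)
Lemma ball_perm_word (I : finType) (k : nat) (w : seq I) :
  reduced w -> (size w <= k)%N ->
  (\prod_(i <- w) ball_perm k i)%g [bseq] = rev w :> seq I.
Proof.
elim/last_ind: w => [|w i IH] riw; first by rewrite big_nil perm1.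
rewrite size_rcons => wk; have rw : reduced w.
  by move: riw; rewrite /reduced -cats1 => /cat_sorted2[].
rewrite -cats1 big_cat big_seq1 permM permE /ball_flip.
rewrite /= IH ?(ltnW wk) //.
have rrw v : reduced (rev v) = reduced v.
  by rewrite /reduced rev_sorted; apply: eq_sorted => x y; rewrite eq_sym.
rewrite rrw rw cats1 rev_rcons toggle_notin; last by rewrite -rev_rcons rrw.
by rewrite val_insubd /= size_rev wk.
Qed.

Lemma ball_perm_inj (I : finType) (k : nat) (u v : seq I) :
  reduced u -> reduced v -> (size u <= k)%N -> (size v <= k)%N ->
  (\prod_(i <- u) ball_perm k i = \prod_(i <- v) ball_perm k i)%g -> u = v.
Proof.
move=> ru rv uk vk /permP/(_ [bseq])/(congr1 val)/=.
by rewrite !ball_perm_word // => /(can_inj revK).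
Qed.

Import Order.TTheory GRing.Theory Num.Theory.

Local Open Scope fset_scope.

(** * Edge counting in the forest drawn by free involutions *)

Section FreeInvolutions.
Variables (G : groupType) (I : finType) (b : I -> G).
Hypothesis bb : forall i, (b i * b i = 1)%g.
Hypothesis b_inj : forall u v : seq I, reduced u -> reduced v ->
  (\prod_(i <- u) b i = \prod_(i <- v) b i)%g -> u = v.

Lemma prod_toggle i (w : seq I) :
  (\prod_(j <- toggle i w) b j = b i * \prod_(j <- w) b j)%g.
Proof.
case: w => [|j w] /=; first by rewrite big_seq1 big_nil mulg1.
by case: eqVneq => [<-|_]; rewrite !big_cons // mulgA bb mul1g.
Qed.

Lemma reduced_word (w : seq I) : exists2 v, reduced v &
  (\prod_(j <- w) b j = \prod_(j <- v) b j)%g.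
Proof.
elim: w => [|i w [v rv e]]; first by exists [::].
by exists (toggle i v); rewrite ?reduced_toggle // prod_toggle -e big_cons.
Qed.

(* [p h] is the first edge on the path from [h] to the chosen root of its
   component in the forest that the [b i] draw on [G] by left multiplication. *)
Lemma edge_to_root (i0 : I) :
  exists p : G -> I, forall i h, p h = i \/ p (b i * h)%g = i.
Proof.
pose C (h : G) : set G := [set g |
   exists w : seq I, h = (\prod_(j <- w) b j * g)%g]%classic.
have CE i h : C (b i * h)%g = C h.
  apply/seteqP; split=> g [w]; last first.
    by move=> ->; exists (i :: w); rewrite big_cons mulgA.
  move=> e; exists (i :: w); rewrite big_cons -mulgA -e mulgA bb.
  by rewrite mul1g.
(* [xget] sees only the set, so by [CE] neighbours share their root. *)
pose root h := xget 1%g (C h).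
have Cr h : C h (root h).
  by apply: xgetPex; exists h; exists [::]; rewrite big_nil mul1g.
have /choice[W HW] : forall h, exists w : seq I,
    reduced w /\ h = (\prod_(j <- w) b j * root h)%g.
  move=> h; have [w e] := Cr h; have [v rv ev] := reduced_word w.
  by exists v; rewrite -ev.
(* By [b_inj] the reduced word from the root is unique, so crossing an edge of colour [i] toggles
   it. The default [i0] occurs only at roots, whose word is empty. *)
exists (fun h => head i0 (W h)) => i h.
have WE : W (b i * h)%g = toggle i (W h).
  have [r1 e1] := HW (b i * h)%g; have [r2 e2] := HW h.
  apply: b_inj => //; first exact: reduced_toggle.
  rewrite prod_toggle; apply: (@mulIg _ (root h)).
  have <- : root (b i * h)%g = root h by rewrite /root CE.
  rewrite -e1 -mulgA; congr (_ * _)%g; rewrite {1}e2.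
  by rewrite /root CE.
rewrite WE; case: (W h) => [|j w] /=; first by right.
by case: eqVneq => [->|]; [left|right].
Qed.

Lemma sum_card_ltranslateI (H : {fset G}) :
  (\sum_i #|` ltranslate (b i) H `&` H| <= 2 * #|` H|)%N.
Proof.
have [i0 _|I0] := pickP {: I}; last by rewrite big_pred0.
have [p pP] := edge_to_root i0.
(* Splitting [H] by the colour of the rootward edge lets the bound be proved colour by colour. *)
have -> : #|` H| = (\sum_i #|` [fset h in H | p h == i]|)%N.
  rewrite card_fset_sum1 (partition_big p xpredT) //=.
  apply: eq_bigr => i _; rewrite card_fset_sum1 big_fset_condE.
  by apply: eq_big_seq.
(* An edge inside [H] is charged to whichever endpoint it leads rootwards from. *)
rewrite big_distrr /=; apply: leq_sum => i _.
set P := [fset h in H | p h == i].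
apply: (@leq_trans #|` P `|` ltranslate (b i) P|).
  apply/fsubset_leq_card/fsubsetP => x; rewrite !inE => /andP[].
  move=> /imfsetP[h /= hH ->] bhH; rewrite bhH.
  have [e|->] := pP i h; last by rewrite eqxx.
  by apply/orP; right; apply/imfsetP; exists h; rewrite //= !inE hH e eqxx.
rewrite cardfsU mul2n -addnn; apply: leq_trans (leq_subr _ _) _.
by rewrite leq_add2l leq_imfset_card.
Qed.

End FreeInvolutions.

(** Three involutions are taken because two would generate an infinite dihedral group, which is
    amenable. *)
Lemma free_involutions_no_Folner (R : realType) (G : groupType) (b : 'I_3 -> G)
    (n : nat) (eps : R) (a : n.-tuple G) (H : {fset G}) :
  (forall i, b i * b i = 1)%g ->
  (forall u v : seq 'I_3, reduced u -> reduced v ->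
    (\prod_(i <- u) b i = \prod_(i <- v) b i)%g -> u = v) ->
  (forall i, exists j, b i = tnth a j) -> (eps <= 2^-1)%R ->
  ~ tuple_Folner a eps H.
Proof.
move=> bb b_inj ba eps_le aH.
have bH i : ((2 * #|` H| - 2 * #|` ltranslate (b i) H `&` H|)%:R
    < eps * (#|` H|)%:R)%R.
  have [j e] := ba i; apply: le_lt_trans (aH (b i) _); last first.
    by apply/imfsetP; exists j.
  rewrite ler_nat.
  have bHE : #|` ltranslate (b i) H| = #|` H|.
    by rewrite card_imfset //; exact: mulgI.
  have := cardfsID H (ltranslate (b i) H).
  have := cardfsID (ltranslate (b i) H) H.
  rewrite bHE fsetIC /fsymdiff cardfsU => e1 e2.
  have -> : (ltranslate (b i) H `\` H) `&` (H `\` ltranslate (b i) H) = fset0.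
    by apply/fsetP => x; rewrite !inE; case: (x \in H); rewrite ?andbF.
  by rewrite cardfs0; lia.
have := sum_card_ltranslateI bb b_inj H.
rewrite !big_ord_recl big_ord0 => leH.
(* Each intersection exceeds 3/4 of [H], so the three sum to more than 9/4 of it, against the bound
   2. Strictness also excludes the empty set. *)
have lt2 i : (2 * (2 * #|` H| - 2 * #|` ltranslate (b i) H `&` H|) < #|` H|)%N.
  have := bH i; set m := (_ - _)%N => lt; rewrite -(ltr_nat R) natrM.
  have : (eps * (#|` H|)%:R <= 2^-1 * (#|` H|)%:R)%R by rewrite ler_wpM2r.
  by lra.
move: (lt2 ord0) (lt2 (lift ord0 ord0)) (lt2 (lift ord0 (lift ord0 ord0))).
by lia.
Qed.

(** * Ultraproducts of groups and the theorem of Łoś *)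

Section Ultraproduct.
Variables (K : Type) (G : K -> groupType) (U : set_system K).
Hypothesis UU : UltraFilter U.
Implicit Types f g h : forall k, G k.

Lemma ultra_not (A : set K) : U (~` A)%classic <-> ~ U A.
Proof.
split=> [UnA UA|]; last by case: (in_ultra_setVsetC A UU).
by apply: (@filter_not_empty _ U); rewrite -(setICr A); exact: filterI.
Qed.

Lemma ultra_and (A B : set K) : U (A `&` B)%classic <-> U A /\ U B.
Proof.
split=> [UAB|[]]; last exact: filterI.
by split; apply: filterS UAB => k [].
Qed.

Definition ultra_eq f g : bool := `[< U [set k | f k = g k]%classic >].

Lemma ultra_eq_refl : reflexive ultra_eq.
Proof. by move=> f; apply/asboolP; apply: filterS filterT. Qed.

Lemma ultra_eq_sym : symmetric ultra_eq.
Proof. move=> f g; rewrite /ultra_eq; congr `[< U _ >].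
by apply/seteqP; split=> k /= ->. Qed.

Lemma ultra_eq_trans : transitive ultra_eq.
Proof.
move=> g f h /asboolP fg /asboolP gh; apply/asboolP.
by apply: filterS2 fg gh => k /= ->.
Qed.

Canonical ultra_equiv :=
  EquivRel ultra_eq ultra_eq_refl ultra_eq_sym ultra_eq_trans.

Definition ultraproduct : Type := {eq_quot ultra_equiv}%qT.
HB.instance Definition _ := Choice.on ultraproduct.

Definition ultra_class f : ultraproduct := (\pi_({eq_quot ultra_equiv}) f)%qT.

Lemma ultra_classP f g :
  ultra_class f = ultra_class g <-> U [set k | f k = g k]%classic.
Proof.
rewrite /ultra_class; split=> [/eqP|fg].
  by rewrite piE => /asboolP.
by apply/eqP; rewrite piE; apply/asboolP.
Qed.

Lemma ultra_classW (x : ultraproduct) : exists f, x = ultra_class f.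
Proof. by exists (repr x); rewrite /ultra_class reprK. Qed.

Definition ultra_mul (x y : ultraproduct) : ultraproduct :=
  ultra_class (fun k => repr x k * repr y k)%g.
Definition ultra_inv (x : ultraproduct) : ultraproduct :=
  ultra_class (fun k => (repr x k)^-1)%g.
Definition ultra_one : ultraproduct := ultra_class (fun=> 1%g).

Lemma ultra_repr f : U [set k | repr (ultra_class f) k = f k]%classic.
Proof. by apply/ultra_classP; rewrite /ultra_class reprK. Qed.

(** Chosen representatives agree with [f] and [g] on sets of [U], so the product does not depend on
    the choice and the group laws descend from the factors. *)
Lemma ultra_mulE f g :
  ultra_mul (ultra_class f) (ultra_class g) =
  ultra_class (fun k => f k * g k)%g.
Proof.
apply/ultra_classP.
by apply: filterS2 (ultra_repr f) (ultra_repr g) => k /= -> ->.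
Qed.

Lemma ultra_invE f :
  ultra_inv (ultra_class f) = ultra_class (fun k => (f k)^-1)%g.
Proof. by apply/ultra_classP; apply: filterS (ultra_repr f) => k /= ->. Qed.

Lemma ultra_mulA : associative ultra_mul.
Proof.
move=> x y z; have [f ->] := ultra_classW x.
have [[g ->] [h ->]] := (ultra_classW y, ultra_classW z).
rewrite !ultra_mulE; congr ultra_class.
apply: functional_extensionality_dep => k.
exact: mulgA.
Qed.

Lemma ultra_left_id : left_id ultra_one ultra_mul.
Proof.
move=> x; have [f ->] := ultra_classW x; rewrite ultra_mulE; congr ultra_class.
by apply: functional_extensionality_dep => k; exact: mul1g.
Qed.

Lemma ultra_right_id : right_id ultra_one ultra_mul.
Proof.
move=> x; have [f ->] := ultra_classW x; rewrite ultra_mulE; congr ultra_class.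
by apply: functional_extensionality_dep => k; exact: mulg1.
Qed.

Lemma ultra_left_inv : left_inverse ultra_one ultra_inv ultra_mul.
Proof.
move=> x; have [f ->] := ultra_classW x; rewrite ultra_invE ultra_mulE.
by congr ultra_class; apply: functional_extensionality_dep => k; exact: mulVg.
Qed.

Lemma ultra_right_inv : right_inverse ultra_one ultra_inv ultra_mul.
Proof.
move=> x; have [f ->] := ultra_classW x; rewrite ultra_invE ultra_mulE.
by congr ultra_class; apply: functional_extensionality_dep => k; exact: mulgV.
Qed.

HB.instance Definition _ := isGroup.Build ultraproduct
  ultra_mulA ultra_left_id ultra_right_id ultra_left_inv ultra_right_inv.

Lemma ultra_class_mul f g :
  (ultra_class f * ultra_class g)%g = ultra_class (fun k => f k * g k)%g.
Proof. exact: ultra_mulE. Qed.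

Lemma ultra_class_inv f :
  (ultra_class f)^-1%g = ultra_class (fun k => (f k)^-1)%g.
Proof. exact: ultra_invE. Qed.

Lemma ultra_class_prod (I : Type) (s : seq I) (F : I -> forall k, G k) :
  (\prod_(i <- s) ultra_class (F i))%g =
  ultra_class (fun k => \prod_(i <- s) F i k)%g.
Proof.
elim: s => [|i s IH].
  rewrite big_nil; congr ultra_class; apply: functional_extensionality_dep => k.
  by rewrite big_nil.
rewrite big_cons IH ultra_class_mul; congr ultra_class.
by apply: functional_extensionality_dep => k; rewrite big_cons.
Qed.

Definition tuple_at (n : nat) (a : n.-tuple (forall k, G k)) (k : K) :
  n.-tuple (G k) := map_tuple (fun f : forall k, G k => f k) a.

Lemma tuple_at_cons (n : nat) f (a : n.-tuple (forall k, G k)) (k : K) :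
  tuple_at (cons_tuple f a) k = cons_tuple (f k) (tuple_at a k).
Proof. exact: val_inj. Qed.

Lemma ultra_class_cons (n : nat) f (a : n.-tuple (forall k, G k)) :
  map_tuple ultra_class (cons_tuple f a) =
  cons_tuple (ultra_class f) (map_tuple ultra_class a).
Proof. exact: val_inj. Qed.

Lemma geval_ultra_class (n : nat) (a : n.-tuple (forall k, G k)) (t : gterm n) :
  geval (map_tuple ultra_class a) t =
  ultra_class (fun k => geval (tuple_at a k) t).
Proof.
elim: t => [i||t IH|t IHt u IHu] //=.
- rewrite tnth_map; congr ultra_class.
  apply: functional_extensionality_dep => k.
  by rewrite tnth_map.
- by rewrite IH ultra_class_inv.
- by rewrite IHt IHu ultra_class_mul.
Qed.

Lemma los (n : nat) (phi : gformula n) (a : n.-tuple (forall k, G k)) :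
  gsat phi (map_tuple ultra_class a) <->
  U [set k | gsat phi (tuple_at a k)]%classic.
Proof.
elim: phi a => {n} [n|n t u|n f IH|n f IHf g IHg|n f IHf g IHg|n f IHf g IHg
    |n f IH|n f IH] a /=.
- by split=> // /(@filter_not_empty _ U).
- by rewrite !geval_ultra_class; exact: ultra_classP.
- by rewrite IH -ultra_not.
- by rewrite IHf IHg -ultra_and.
- rewrite IHf IHg; split=> [|Ufg].
    by case; apply: filterS; [left|right].
  apply: contrapT => /not_orP[/ultra_not Unf /ultra_not Ung].
  apply/ultra_not: Ufg.
  by apply: filterS2 Unf Ung => k nf ng [].
- rewrite IHf IHg; split=> [fg|Ufg Uf]; last first.
    by apply: filterS2 Ufg Uf => k; apply.
  have [/fg Ug|/ultra_not] := EM (U [set k | gsat f (tuple_at a k)]%classic).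
    by apply: filterS Ug => k gk _.
  by apply: filterS => k nf /nf.
- split=> [fa|Uf x]; last first.
    have [h ->] := ultra_classW x; rewrite -ultra_class_cons IH.
    by apply: filterS Uf => k /= /(_ (h k)); rewrite tuple_at_cons.
  (* In each factor, pick a counterexample to [f] if there is one: [f] at this element then decides
     the universal formula. *)
  have hP k : {x : G k | gsat f (cons_tuple x (tuple_at a k)) ->
      forall x : G k, gsat f (cons_tuple x (tuple_at a k))}.
    apply: cid; apply: contrapT => /forallNP nf; apply: (nf 1%g) => _ x.
    by apply: contrapT => nfx; apply: (nf x).
  have := fa (ultra_class (fun k => sval (hP k))); rewrite -ultra_class_cons IH.
  by apply: filterS => k; rewrite /= tuple_at_cons; exact: svalP (hP k).
- split=> [[x]|Uf].
    have [h ->] := ultra_classW x; rewrite -ultra_class_cons IH.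
    by apply: filterS => k; rewrite /= tuple_at_cons; exists (h k).
  (* A witness where one exists, and 1 elsewhere. *)
  have hP k : {x : G k |
      (exists y : G k, gsat f (cons_tuple y (tuple_at a k))) ->
      gsat f (cons_tuple x (tuple_at a k))}.
    apply: cid.
    have [[y fy]|nf] := EM (exists y, gsat f (cons_tuple y (tuple_at a k))).
      by exists y.
    by exists 1%g.
  exists (ultra_class (fun k => sval (hP k))); rewrite -ultra_class_cons IH.
  by apply: filterS Uf => k; rewrite /= tuple_at_cons; exact: svalP (hP k).
Qed.

End Ultraproduct.

(** * Finite groups and undefinability *)

Lemma finite_tuple_Folner (R : realType) (G : finGroupType) (n : nat)
    (a : n.-tuple G) (eps : R) :
  (0 < eps)%R -> tuple_Folner a eps [fset x in G].
Proof.
move=> eps0 g _.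
have -> : ltranslate g [fset x in G] = [fset x in G].
  apply/fsetP => x; rewrite !inE; apply/imfsetP; exists (g^-1 * x)%g.
    by rewrite /= !inE.
  by rewrite mulKVg.
rewrite /fsymdiff fsetUid fsetDv cardfs0 mulr_gt0 // ltr0n cardfs_gt0.
by apply/fset0Pn; exists 1%g; rewrite !inE.
Qed.

Theorem theorem3p3p1 (R : realType) :
  exists (n0 : nat) (eps0 : R), (0 < eps0)%R /\
    forall (n : nat) (eps : R), (n0 <= n)%N -> (0 < eps)%R -> (eps <= eps0)%R ->
      ~ exists psi : gformula n,
          forall (G : groupType) (a : n.-tuple G),
            gsat psi a <-> ~ exists H : {fset G}, tuple_Folner a eps H.
Proof.
exists 3, 2^-1%R; split; first by rewrite invr_gt0.
move=> n eps n3 eps_gt0 eps_le [psi psiP].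
(* Refining [\oo] puts every tail of the naturals in [U]. *)
have [U [UU ooU]] := @ultraFilterLemma nat \oo%classic _.
pose G k := {perm k.-bseq 'I_3}.
pose f (i : 'I_3) : forall k, G k := fun k => ball_perm k i.
pose b i := ultra_class UU (f i).
(* [inord] sends indices from 3 on to 0, so the remaining entries repeat the first involution. *)
pose a := [tuple f (inord i) | i < n].
have Ufalse : gsat psi (map_tuple (ultra_class UU) a) -> False.
  move=> /los Upsi; apply: (@filter_not_empty _ U _).
  apply: filterS Upsi => k /psiP; apply.
  by exists [fset x in G k]; exact: finite_tuple_Folner.
apply/Ufalse/psiP => -[H]; apply: (free_involutions_no_Folner (b := b)) => //.
- move=> i; rewrite ultra_class_mul; apply/ultra_classP.
  by apply: filterS filterT => k _; exact: ball_permK.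
- move=> u v ru rv; rewrite !ultra_class_prod => /ultra_classP Uuv.
  (* A single factor whose radius bounds both lengths suffices to separate the words. *)
  have Ule : U [set k | size u + size v <= k]%N%classic.
    by apply: ooU; exists (size u + size v)%N.
  have [k [uv lek]] := @filter_ex _ U _ _ (filterI Uuv Ule).
  apply: ball_perm_inj uv => //; apply: leq_trans lek.
    exact: leq_addr.
  exact: leq_addl.
- move=> i; exists (widen_ord n3 i); rewrite tnth_map tnth_mktuple /b.
  by rewrite inord_val.
Qed.
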